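(* For every $n\ge0$ and every permutation $\pi\in\mathfrak S_n$, $\widehat\phi(\pi)=\varphi(\pi)$.
   Context: $\mathfrak S_n$ is the symmetric group on $[n]$ in one-line notation; $\mathfrak S_0=\{\emptyset\}$. For $n\ge1$, $Y_n$ is the set of planar binary trees with $n$ internal nodes ($n+1$ leaves ordered left to right); $Y_0=\{\ast\}$, the trivial one-vertex tree. $T_1\vee T_2$ is the tree with a new root with left subtree $T_1$ and right subtree $T_2$. Let $t\in Y_1$ be the 2-corolla; for $T\in Y_p$ and $1\le i\le p+1$, $T\triangleleft_i t$ is the tree obtained by grafting $t$ onto the $i$-th leaf of $T$. $\mathrm{std}(a)$ is the standardization of a word $a$ of distinct integers ($\mathrm{std}(\emptyset)=\emptyset$). For a word $a$ and integer $x$, $a^{<x}$ (resp. $a^{>x}$) is the subsequence of entries of $a$ strictly less (resp. greater) than $x$, in the original order. Define $\widehat\phi:\mathfrak S_n\to Y_n$ by $\widehat\phi(\emptyset)=\ast$, $\widehat\phi(1)=t$, and $\widehat\phi(\pi)=\widehat\phi(\mathrm{std}(\pi_2\cdots\pi_n))\triangleleft_{\pi_1}t$ for $n>1$. Define $\varphi:\mathfrak S_n\to Y_n$ by $\varphi(\emptyset)=\ast$ and, for $n>0$, $\varphi(\pi)=\varphi(\mathrm{std}(\pi^{<\pi_n}))\vee\varphi(\mathrm{std}(\pi^{>\pi_n}))$ (an empty subsequence yields $\ast$). *)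

(* Defs.v *)
From Stdlib Require Import FunInd Recdef.
From HB Require Import structures.
From mathcomp Require Import all_boot all_fingroup.

Set Implicit Arguments.
Unset Strict Implicit.
Unset Printing Implicit Defensive.

Inductive tree := Leaf | Node of tree & tree.

Fixpoint nodes (T : tree) : nat :=
  if T is Node T1 T2 then (nodes T1 + nodes T2).+1 else 0.

Fixpoint leaves (T : tree) : nat :=
  if T is Node T1 T2 then leaves T1 + leaves T2 else 1.

Definition Y (n : nat) := {T : tree | nodes T == n}.

Definition corolla : tree := Node Leaf Leaf.

(* [graft T i S] replaces the [i]-th leaf of [T] by [S]; leaves are numbered  *)
(* from 1, left to right, and [T] is unchanged unless 1 <= i <= leaves T.     *)
Fixpoint graft (T : tree) (i : nat) (S : tree) : tree :=
  if T is Node T1 T2 then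
    if i <= leaves T1 then Node (graft T1 i S) T2
    else Node T1 (graft T2 (i - leaves T1) S)
  else if i == 1 then S else Leaf.

Definition std (a : seq nat) : seq nat :=
  [seq (count (fun y => y < x) a).+1 | x <- a].

Definition sub_lt (a : seq nat) (x : nat) : seq nat := [seq y <- a | y < x].
Definition sub_gt (a : seq nat) (x : nat) : seq nat := [seq y <- a | x < y].

Lemma size_std a : size (std a) = size a.
Proof. exact: size_map. Qed.

Lemma std_bounds a : all (fun x => 0 < x <= size (std a)) (std a).
Proof.
apply/allP => _ /mapP[x xa ->]; rewrite size_std /=.
rewrite ltn_neqAle count_size andbT -all_count; apply/negP => /allP /(_ x xa).
by rewrite ltnn.
Qed.

Lemma sub_lt_size a x : x \in a -> size (sub_lt a x) < size a.
Proof.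
move=> xa; rewrite size_filter ltn_neqAle count_size andbT -all_count.
by apply/negP => /allP /(_ x xa); rewrite ltnn.
Qed.

Lemma sub_gt_size a x : x \in a -> size (sub_gt a x) < size a.
Proof.
move=> xa; rewrite size_filter ltn_neqAle count_size andbT -all_count.
by apply/negP => /allP /(_ x xa); rewrite ltnn.
Qed.

(* The two maps are first defined on words; the recursion is on the length.   *)
Function phi_hat_word (w : seq nat) {measure size w} : tree :=
  match w with
  | [::] => Leaf
  | [:: _] => corolla
  | x :: (_ :: _) as v => graft (phi_hat_word (std v)) x corolla
  end.
Proof. by move=> w x v y v' _ _; apply/ltP; rewrite size_std. Defined.

Function phi_word (w : seq nat) {measure size w} : tree :=
  match w with
  | [::] => Leaf
  | x :: v => Node (phi_word (std (sub_lt w (last x v))))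
                   (phi_word (std (sub_gt w (last x v))))
  end.
Proof.
- by move=> w x v _; apply/ltP; rewrite size_std sub_gt_size ?mem_last.
- by move=> w x v _; apply/ltP; rewrite size_std sub_lt_size ?mem_last.
Defined.

Lemma leavesE T : leaves T = (nodes T).+1.
Proof. by elim: T => //= T1 -> T2 ->; rewrite addSn addnS. Qed.

Lemma nodes_graft T i : 0 < i <= leaves T ->
  nodes (graft T i corolla) = (nodes T).+1.
Proof.
elim: T i => [|T1 IH1 T2 IH2] i /=; first by case: i => [|[|]].
case: (leqP i (leaves T1)) => [le_i /andP[i_gt0 _]|lt_i /andP[_ le_i]] /=.
  by rewrite IH1 ?i_gt0 ?le_i.
by rewrite IH2 ?addnS // subn_gt0 lt_i leq_subLR.
Qed.

Lemma nodes_phi_hat_word w :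
  all (fun x => 0 < x <= size w) w -> nodes (phi_hat_word w) = size w.
Proof.
have [n] := ubnP (size w); elim: n w => // n IH w.
rewrite phi_hat_word_equation; case: w => [|x [|y w]] // lt_n /andP[x_in _].
have IHv := IH (std (y :: w)); rewrite size_std in IHv.
have {}IHv: nodes (phi_hat_word (std (y :: w))) = size (y :: w).
  by apply: IHv => //; rewrite -{1}(size_std (y :: w)) std_bounds.
by rewrite nodes_graft ?IHv // leavesE IHv.
Qed.

Lemma std_uniq a : uniq a -> uniq (std a).
Proof.
move=> ua; rewrite map_inj_in_uniq // => x y xa ya [].
have H u v : u \in a -> u < v ->
    count (fun z => z < u) a < count (fun z => z < v) a.
  move=> ua' uv; rewrite -[X in _ < X]size_filter.
  have -> : count (fun z => z < u) a = size (sub_lt (sub_lt a v) u).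
    rewrite /sub_lt -filter_predI size_filter; apply: eq_count => z /=.
    by case: (ltnP z u) => //= zu; rewrite (ltn_trans zu uv).
  by apply: sub_lt_size; rewrite mem_filter uv.
by case: (ltngtP x y) => // /H E eq_c; [have := E xa | have := E ya];
  rewrite eq_c ltnn.
Qed.

Lemma nodes_phi_word w : uniq w -> nodes (phi_word w) = size w.
Proof.
have [n] := ubnP (size w); elim: n w => // n IH w.
rewrite phi_word_equation; case: w => [|x v] //.
move: (mem_last x v); move: (x :: v) (last x v) => w z zw lt_n uw.
have lt_lt : size (sub_lt w z) < n by apply: leq_trans (sub_lt_size zw) _.
have lt_gt : size (sub_gt w z) < n by apply: leq_trans (sub_gt_size zw) _.
rewrite [nodes _]/= !IH ?size_std ?std_uniq ?filter_uniq //.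
rewrite !size_filter -(count_predC (fun y => y < z) w) -addnS; congr (_ + _).
have -> : count (predC (fun y => y < z)) w =
    count (predU (pred1 z) (fun y => z < y)) w.
  by apply: eq_count => y /=; rewrite -leqNgt leq_eqVlt eq_sym.
have := count_predUI (pred1 z) (fun y => z < y) w.
rewrite (@eq_count _ (predI _ _) pred0) => [|y] /=; last first.
  by case: eqP => //= ->; rewrite ltnn.
by rewrite count_pred0 addn0 count_uniq_mem // zw.
Qed.

Definition one_line (n : nat) (s : 'S_n) : seq nat :=
  [seq (s i : nat).+1 | i <- enum 'I_n].

Lemma size_one_line n (s : 'S_n) : size (one_line s) = n.
Proof. by rewrite size_map size_enum_ord. Qed.

Lemma phi_hat_subproof n (s : 'S_n) : nodes (phi_hat_word (one_line s)) == n.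
Proof.
rewrite nodes_phi_hat_word size_one_line //.
by apply/allP => _ /mapP[i _ ->]; rewrite ltn_ord.
Qed.

Lemma phi_subproof n (s : 'S_n) : nodes (phi_word (one_line s)) == n.
Proof.
rewrite nodes_phi_word ?size_one_line // map_inj_uniq ?enum_uniq // => i j [].
by move/val_inj/perm_inj.
Qed.

Definition phi_hat (n : nat) (s : 'S_n) : Y n :=
  exist _ (phi_hat_word (one_line s)) (phi_hat_subproof s).

Definition phi (n : nat) (s : 'S_n) : Y n :=
  exist _ (phi_word (one_line s)) (phi_subproof s).

(* Main.v *)
Require Import Defs.
From mathcomp Require Import all_boot all_fingroup.
From mathcomp Require Import zify.

(** The map [phi_word] depends only on the relative order of the letters, so
    the standardizations in its recursion can be dropped.  Prepending a letter
    [x] to a word [v] then amounts to inserting [x] into the binary search tree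
    of [v] read from right to left: [x] is compared with the last letter [z] of
    [v] and goes to the left or right subtree, ending at the leaf whose index is
    one plus the number of letters of [v] below [x].  For a standard word
    [x :: v] that index is [x] itself, which is the recursion of
    [phi_hat_word]. *)

Lemma std_map (f : nat -> nat) (a : seq nat) :
  {in a &, {mono f : x y / x < y}} -> std (map f a) = std a.
Proof.
move=> f_mono; rewrite /std -map_comp; apply/eq_in_map => x xa /=.
by rewrite count_map; congr _.+1; apply: eq_in_count => y ya /=; exact: f_mono.
Qed.

Lemma count_ltn_split (a : seq nat) (z x : nat) : z < x ->
  count (fun y => y < x) a =
    count (fun y => y < z) a + count_mem z a +
    count (fun y => y < x) (sub_gt a z).
Proof.
move=> lt_zx; elim: a => //= y a ->; rewrite /sub_gt /=.
by case: (ltngtP y z) => [lt_yz|lt_zy|->] /=; lia.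
Qed.

Lemma count_ltn_mono (a : seq nat) :
  {in a &, {mono (fun x => (count (fun y => y < x) a).+1) : x y / x < y}}.
Proof.
have count_le x y : x <= y ->
    count (fun z => z < x) a <= count (fun z => z < y) a.
  by move=> le_xy; apply: sub_count => z /= /leq_trans; apply.
move=> x y xa ya; rewrite ltnS; case: (ltnP x y) => [lt_xy|/count_le].
  (* The inequality is strict because [x] itself occurs in [a] and lies below [y]. *)
  rewrite (count_ltn_split _ _ _ lt_xy) -addnA -addn1 leq_add2l.
  by rewrite ltn_addr // -has_count has_pred1.
by rewrite leqNgt => /negbTE.
Qed.

Lemma std_std (a : seq nat) : std (std a) = std a.
Proof. exact/std_map/count_ltn_mono. Qed.

Lemma phi_word_map (f : nat -> nat) (w : seq nat) :
  {in w &, {mono f : x y / x < y}} -> phi_word (map f w) = phi_word w.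
Proof.
case: w => [//|x v] f_mono.
rewrite map_cons phi_word_equation [in RHS]phi_word_equation.
rewrite -map_cons last_map; move: (mem_last x v) f_mono.
move: (x :: v) (last x v) => w z zw f_mono.
have sub_f (p q : pred nat) : {in w, p \o f =1 q} ->
    std (filter p (map f w)) = std (filter q w).
  move=> pq; rewrite filter_map (eq_in_filter pq) std_map // => a b.
  by rewrite !mem_filter => /andP[_ aw] /andP[_ bw]; exact: f_mono.
by congr (Node (phi_word _) (phi_word _)); apply: sub_f => y yw;
  exact: f_mono.
Qed.

Lemma phi_word_std (w : seq nat) : phi_word (std w) = phi_word w.
Proof. exact/phi_word_map/count_ltn_mono. Qed.

Lemma phi_word_cons (x : nat) (v : seq nat) :
  phi_word (x :: v) = Node (phi_word (sub_lt (x :: v) (last x v)))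
                           (phi_word (sub_gt (x :: v) (last x v))).
Proof. by rewrite phi_word_equation !phi_word_std. Qed.

Lemma phi_word_graft (x : nat) (v : seq nat) : uniq (x :: v) ->
  phi_word (x :: v) =
    graft (phi_word v) (count (fun y => y < x) v).+1 corolla.
Proof.
have [n] := ubnP (size v); elim: n v => // n IH [|y v'] lt_n.
  by rewrite phi_word_cons /sub_lt /sub_gt /= ltnn phi_word_equation.
rewrite cons_uniq => /andP[].
rewrite phi_word_cons (phi_word_cons y) [last x _]/=.
move: (mem_last y v') lt_n; move: (y :: v') (last y v') => v z zv lt_n xv uv.
have IHf (p : pred nat) : size (filter p v) < n ->
    phi_word (x :: filter p v) = graft (phi_word (filter p v))
      (count (fun y => y < x) (filter p v)).+1 corolla.
  move=> lt_p; apply: IH => //.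
  by rewrite cons_uniq mem_filter negb_and xv orbT filter_uniq.
(* The left subtree has one leaf more than [v] has letters below [z], so [graft] compares the counts
   below [x] and below [z]. *)
rewrite [graft _ _ _]/= leavesE nodes_phi_word ?filter_uniq // size_filter ltnS.
case: (ltngtP x z) => [lt_xz|lt_zx|eq_xz]; last by rewrite eq_xz zv in xv.
- rewrite /sub_lt /sub_gt /= lt_xz ltnNge ltnW //=.
  rewrite IHf ?(leq_trans (sub_lt_size zv)) //.
  have -> : count (fun y => y < x) v <= count (fun y => y < z) v.
    by apply: sub_count => t /= /ltn_trans; apply.
  rewrite count_filter; congr (Node (graft _ _.+1 _) _).
  apply: eq_count => t /=; case: ltnP => //= lt_tx.
  by rewrite (ltn_trans lt_tx).
rewrite /sub_lt /sub_gt /= lt_zx ltnNge ltnW //=.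
rewrite IHf ?(leq_trans (sub_gt_size zv)) //.
(* The letters below [z], together with [z] itself, match the leaves of the left subtree that
   [graft] subtracts. *)
rewrite (count_ltn_split v z x lt_zx) count_uniq_mem // zv addn1.
by rewrite leqNgt ltnS leq_addr /= -addnS addKn.
Qed.

Lemma phi_hat_word_std (w : seq nat) :
  uniq w -> phi_hat_word (std w) = phi_word w.
Proof.
have [n] := ubnP (size w); elim: n w => // n IH w lt_n uw.
(* Pass to [std w], a fixed point of [std], where each letter equals one plus the number of letters
   below it. *)
move: lt_n (std_uniq uw); rewrite -phi_word_std -(size_std w).
move: (std_std w); move: (std w) => {uw}[|x [|y v]] std_w lt_n uw.
- by rewrite phi_hat_word_equation phi_word_equation.
- by rewrite phi_hat_word_equation phi_word_graft // phi_word_equation.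
rewrite phi_hat_word_equation phi_word_graft // IH //; last by case/andP: uw.
have {1}<- : (count (fun t => t < x) (x :: y :: v)).+1 = x by case: std_w.
by rewrite /= ltnn.
Qed.

Lemma uniq_one_line (n : nat) (s : 'S_n) : uniq (one_line s).
Proof.
by rewrite map_inj_uniq ?enum_uniq // => i j [] /val_inj/perm_inj.
Qed.

Lemma perm_one_line (n : nat) (s : 'S_n) : perm_eq (one_line s) (iota 1 n).
Proof.
apply: uniq_perm; rewrite ?uniq_one_line ?iota_uniq //.
apply: (uniq_min_size (uniq_one_line n s) _ _).2.
  by move=> _ /mapP[i _ ->]; rewrite mem_iota; exact: ltn_ord.
by rewrite size_iota size_one_line.
Qed.

(** In a rearrangement of 1, ..., n, exactly [s i] letters lie below [(s i).+1]. *)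
Lemma std_one_line (n : nat) (s : 'S_n) : std (one_line s) = one_line s.
Proof.
rewrite -[RHS]map_id; apply/eq_in_map => _ /mapP[i _ ->]; congr _.+1.
rewrite (seq.permP (perm_one_line n s)) -size_filter.
by rewrite (filter_iota_ltn 1 (ltnW (ltn_ord (s i)))) size_iota.
Qed.

Theorem theorem4p8 (n : nat) (s : 'S_n) : phi_hat s = phi s.
Proof.
apply: val_inj => /=.
by rewrite -{1}std_one_line phi_hat_word_std ?uniq_one_line.
Qed.
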